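(* Let $r:\mathbb{R}^n\to(0,\infty)$ be smooth, and let $\mathcal C$ be the canonical relation of the spherical Radon transform $R$ with radius function $r$. The left projection $\Pi_L$ of $\mathcal C$ is an immersion if and only if $$|\nabla_{\mathbf y} r(\mathbf y)|<1\quad\text{for all }\mathbf y\in\mathbb{R}^n.$$
   Context: $R$ is the transform $Rf(\mathbf y)=\int_{S(\mathbf y)}f\,dS$, with $S(\mathbf y)=\{\mathbf x\in\mathbb{R}^n:|\mathbf x-\mathbf y|=r(\mathbf y)\}$ and $dS$ surface measure, with phase function $\Phi(\mathbf y,\mathbf x,\sigma)=\sigma(|\mathbf x-\mathbf y|^2-r(\mathbf y)^2)$. $T^*(\mathbb{R}^n)$ is identified with $\mathbb{R}^n\times\mathbb{R}^n$. The canonical relation is $$\mathcal C=\left\{\left(\mathbf y,-2\sigma r(\mathbf y)(\omega+\nabla_{\mathbf y} r(\mathbf y));\ \mathbf y+r(\mathbf y)\omega,-2\sigma r(\mathbf y)\omega\right):\ \mathbf y\in\mathbb{R}^n,\ \omega\in S^{n-1},\ \sigma\in\mathbb{R}\setminus\{0\}\right\},$$ with global coordinates $(\mathbf y,\omega,\sigma)$. The left projection is $\Pi_L:\mathcal C\to T^*(\mathbb{R}^n)$, $\Pi_L(\mathbf y,\eta;\mathbf x,\xi)=(\mathbf y,\eta)$. *)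

(* Defs.v *)
From HB Require Import structures.
From mathcomp Require Import all_boot all_order all_algebra.
From mathcomp Require Import all_classical all_reals all_analysis.

Set Implicit Arguments.
Unset Strict Implicit.
Unset Printing Implicit Defensive.

Import Order.TTheory GRing.Theory Num.Theory.
Import numFieldNormedType.Exports.

Local Open Scope classical_set_scope.
Local Open Scope ring_scope.

(* The library norm `|v| on row vectors is the sup norm. *)
Definition eucl_norm (R : realType) (n : nat) (v : 'rV[R]_n) : R :=
  Num.sqrt (\sum_i v 0 i ^+ 2).

Definition grad (R : realType) (n : nat) (f : 'rV[R]_n -> R) (y : 'rV[R]_n) :
  'rV[R]_n := \row_i 'D_(delta_mx 0 i) f y.

(* V is meant to be finite-dimensional: f is then of class C^(k+1) exactly when
   it is differentiable and all its directional derivatives are of class C^k. *)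
Fixpoint class_C (R : realType) (V W : normedModType R) (k : nat)
    (f : V -> W) : Prop :=
  match k with
  | 0 => continuous f
  | k'.+1 => (forall x, differentiable f x) /\
             (forall v, class_C k' (fun x => 'D_v f x))
  end.

Definition smooth (R : realType) (V W : normedModType R) (f : V -> W) : Prop :=
  forall k, class_C k f.

(* Velocities at p of curves lying in M and differentiable at p.  When M is an
   embedded submanifold of the finite-dimensional space V, this is T_p M seen
   as a subspace of V. *)
Definition tangent (R : realType) (V : normedModType R) (M : set V) (p : V) :
    set V :=
  [set v | exists gamma : R -> V,
     [/\ gamma 0 = p,
         \forall t \near (0 : R), M (gamma t) &
         is_derive (0 : R) (1 : R) gamma v]].

(* The restriction of f to the embedded submanifold M is an immersion: its
   differential at p is 'd f p restricted to T_p M. *)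
Definition immersion_on (R : realType) (V W : normedModType R) (M : set V)
    (f : V -> W) : Prop :=
  forall p, M p ->
    differentiable f p /\
    forall v, tangent M p v -> 'd f p v = 0 -> v = 0.

(* R^n x R^n, as (base point, covector) *)
Notation cotangent R n := ('rV[R]_n * 'rV[R]_n)%type.

(* The point ((y, d_y Phi), (x, - d_x Phi)) of the twisted conormal bundle
   { d_sigma Phi = 0 }, for Phi = sigma (|x - y|^2 - r(y)^2) and
   x = y + r(y) omega. *)
Definition canonical_point (R : realType) (n : nat) (r : 'rV[R]_n -> R)
    (y omega : 'rV[R]_n) (sigma : R) : cotangent R n * cotangent R n :=
  ((y, (- 2 * sigma * r y) *: (omega + grad r y)),
   (y + r y *: omega, (- 2 * sigma * r y) *: omega)).

(* Since r > 0 is smooth, (y, omega, sigma) |-> canonical_point r y omega sigma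
   is a smooth embedding of R^n x S^(n-1) x (R \ {0}): omega and sigma are
   smooth functions of (y, x, xi).  So the structure given by these global
   coordinates is the one of an embedded submanifold. *)
Definition canonical_relation (R : realType) (n : nat) (r : 'rV[R]_n -> R) :
    set (cotangent R n * cotangent R n) :=
  [set p | exists y omega sigma,
     [/\ eucl_norm omega = 1, sigma != 0 &
         p = canonical_point r y omega sigma]].

Definition left_projection (R : realType) (n : nat)
    (p : cotangent R n * cotangent R n) : cotangent R n := p.1.

(* Main.v *)
(* In the coordinates (y, omega, sigma), a tangent vector killed by the
   differential of the left projection has dy = 0 and
   dsigma (omega + grad r) + sigma domega = 0.  Since domega is orthogonal to
   omega, pairing with omega gives dsigma (1 + omega . grad r) = 0, so the left
   projection is an immersion iff 1 + omega . grad r never vanishes.  This holds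
   if |grad r| < 1.  Conversely, if 1 + omega . grad r(y) <> 0 for all y, it is
   positive: it has constant sign along a line of direction omega, and were it
   negative, r would decrease there with slope at most -1 and could not stay
   positive.  Taking omega = - grad r / |grad r| at y yields |grad r(y)| < 1.
   This argument also covers n = 1, where the sphere is discrete. *)

Require Import Defs.
From mathcomp Require Import all_boot all_order all_algebra.
From mathcomp Require Import all_classical all_reals all_analysis.
From mathcomp Require Import ring lra.
Import Order.TTheory GRing.Theory Num.Theory.
Import numFieldNormedType.Exports.
Local Open Scope ring_scope.

Set Implicit Arguments.
Unset Strict Implicit.

(** * Euclidean inner product on row vectors *)

Definition dot (R : realType) (n : nat) (u v : 'rV[R]_n) : R :=
  \sum_i u 0 i * v 0 i.

Lemma dotC (R : realType) (n : nat) (u v : 'rV[R]_n) : dot u v = dot v u.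
Proof. by apply: eq_bigr => i _; rewrite mulrC. Qed.

Lemma dotDl (R : realType) (n : nat) (u v w : 'rV[R]_n) :
  dot (u + v) w = dot u w + dot v w.
Proof. by rewrite -big_split/=; apply: eq_bigr => i _; rewrite mxE mulrDl. Qed.

Lemma dotZl (R : realType) (n : nat) (k : R) (u v : 'rV[R]_n) :
  dot (k *: u) v = k * dot u v.
Proof.
by rewrite /dot big_distrr/=; apply: eq_bigr => i _; rewrite mxE mulrA.
Qed.

Lemma dotDr (R : realType) (n : nat) (u v w : 'rV[R]_n) :
  dot w (u + v) = dot w u + dot w v.
Proof. by rewrite dotC dotDl !(dotC w). Qed.

Lemma dotZr (R : realType) (n : nat) (k : R) (u v : 'rV[R]_n) :
  dot v (k *: u) = k * dot v u.
Proof. by rewrite dotC dotZl dotC. Qed.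

Lemma dotNl (R : realType) (n : nat) (u v : 'rV[R]_n) : dot (- u) v = - dot u v.
Proof. by rewrite -scaleN1r dotZl mulN1r. Qed.

Lemma dot0l (R : realType) (n : nat) (v : 'rV[R]_n) : dot 0 v = 0.
Proof. by rewrite -(scale0r v) dotZl mul0r. Qed.

Lemma dot_ge0 (R : realType) (n : nat) (u : 'rV[R]_n) : 0 <= dot u u.
Proof. by apply: sumr_ge0 => i _; rewrite -expr2 sqr_ge0. Qed.

Lemma eucl_normE (R : realType) (n : nat) (u : 'rV[R]_n) :
  eucl_norm u = Num.sqrt (dot u u).
Proof. by []. Qed.

Lemma eucl_norm_eq1 (R : realType) (n : nat) (u : 'rV[R]_n) :
  eucl_norm u = 1 <-> dot u u = 1.
Proof.
rewrite eucl_normE; split=> [u1|->]; last exact: sqrtr1.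
by rewrite -[dot u u]sqr_sqrtr ?dot_ge0// u1 expr1n.
Qed.

(** * Velocities of curves *)

Lemma is_derive_chain (R : realType) (V W : normedModType R) (f : V -> W)
    (c : R -> V) (t : R) (v : V) :
  is_derive t (1 : R) c v -> differentiable f (c t) ->
  is_derive t (1 : R) (f \o c) ('d f (c t) v).
Proof.
move=> [/derivable1_diffP dc cv] df.
have dfc : differentiable (f \o c) t by exact: differentiable_comp.
split; first exact: diff_derivable.
by rewrite deriveE// diff_comp//= -(deriveE _ dc) cv.
Qed.

Lemma is_derive_linear (R : realType) (V W : normedModType R)
    (f : {linear V -> W}) (c : R -> V) (t : R) (v : V) :
  continuous f -> is_derive t (1 : R) c v ->
  is_derive t (1 : R) (f \o c) (f v).
Proof.
move=> fcont dc.
by rewrite -[X in X v](diff_lin (c t) fcont); apply: is_derive_chain => //;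
  exact: linear_differentiable.
Qed.

Lemma continuous_fst (T U : topologicalType) : continuous (@fst T U).
Proof. by move=> p; exact: cvg_fst. Qed.

Lemma continuous_snd (T U : topologicalType) : continuous (@snd T U).
Proof. by move=> p; exact: cvg_snd. Qed.

Lemma is_derive_fst (R : realType) (V W : normedModType R) (c : R -> V * W)
    (t : R) (v : V * W) :
  is_derive t (1 : R) c v -> is_derive t (1 : R) (fun s => (c s).1) v.1.
Proof. by move=> dc; apply: is_derive_linear dc; exact: continuous_fst. Qed.

Lemma is_derive_snd (R : realType) (V W : normedModType R) (c : R -> V * W)
    (t : R) (v : V * W) :
  is_derive t (1 : R) c v -> is_derive t (1 : R) (fun s => (c s).2) v.2.
Proof. by move=> dc; apply: is_derive_linear dc; exact: continuous_snd. Qed.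

Lemma is_derive_pair (R : realType) (V W : normedModType R) (c : R -> V)
    (e : R -> W) (t : R) (v : V) (w : W) :
  is_derive t (1 : R) c v -> is_derive t (1 : R) e w ->
  is_derive t (1 : R) (fun s => (c s, e s)) (v, w).
Proof.
move=> [/derivable1_diffP dc cv] [/derivable1_diffP de ew].
have dce : differentiable (fun s => (c s, e s)) t by exact: differentiable_pair.
split; first exact: diff_derivable.
by rewrite deriveE// diff_pair//= -(deriveE _ dc) -(deriveE _ de) cv ew.
Qed.

Lemma is_derive_rowP (R : realType) (n : nat) (c : R -> 'rV[R]_n) (t : R)
    (v : 'rV[R]_n) :
  is_derive t (1 : R) c v <->
  forall i, is_derive t (1 : R) (fun s => c s 0 i : R) (v 0 i).
Proof.
split=> [[dc cv] i|dc].
  split; first by move/derivable_mxP : dc; exact.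
  by rewrite -cv derive_mx// mxE.
have dc' : derivable c t 1.
  by apply/derivable_mxP => i j; rewrite (ord1 i); case: (dc j).
split=> //; rewrite derive_mx//; apply/rowP => i; rewrite mxE.
by case: (dc i).
Qed.

Lemma is_derive_mulr (R : realType) (f g : R -> R) (t df dg : R) :
  is_derive t (1 : R) f df -> is_derive t (1 : R) g dg ->
  is_derive t (1 : R) (fun s => f s * g s) (df * g t + f t * dg).
Proof.
move=> f_df g_dg; have -> : df * g t + f t * dg = f t *: dg + g t *: df.
  by rewrite addrC [df * _]mulrC.
exact: is_deriveM.
Qed.

Lemma is_derive_dot (R : realType) (n : nat) (c e : R -> 'rV[R]_n) (t : R)
    (v w : 'rV[R]_n) :
  is_derive t (1 : R) c v -> is_derive t (1 : R) e w ->
  is_derive t (1 : R) (fun s => dot (c s) (e s)) (dot v (e t) + dot (c t) w).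
Proof.
move=> /is_derive_rowP dc /is_derive_rowP de.
rewrite /dot -big_split/=.
have -> : (fun s => \sum_i c s 0 i * e s 0 i) =
  \sum_(i < n) (fun s => c s 0 i * e s 0 i).
  by apply/funext => s; rewrite fct_sumE.
by apply: is_derive_sum => i; exact: is_derive_mulr.
Qed.

Lemma is_derive_scale (R : realType) (n : nat) (k : R -> R)
    (c : R -> 'rV[R]_n) (t dk : R) (v : 'rV[R]_n) :
  is_derive t (1 : R) k dk -> is_derive t (1 : R) c v ->
  is_derive t (1 : R) (fun s => k s *: c s) (dk *: c t + k t *: v).
Proof.
move=> dk_ /is_derive_rowP dc; apply/is_derive_rowP => i.
rewrite !mxE; under eq_fun do rewrite mxE.
exact: is_derive_mulr.
Qed.

(** Turns a relation holding along a curve near [t] into a linear relation between velocities. *)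
Lemma near_eq_is_derive_unique (R : realType) (V : normedModType R)
    (c e : R -> V) (t : R) (v w : V) :
  (\forall s \near t, c s = e s) ->
  is_derive t (1 : R) c v -> is_derive t (1 : R) e w -> v = w.
Proof.
by move=> ce dc de; move: (near_eq_is_derive ce dc) => [_ <-]; case: de.
Qed.

(** * Differentials of [r] and of the left projection *)

Lemma diff_grad (R : realType) (n : nat) (f : 'rV[R]_n -> R) (y v : 'rV[R]_n) :
  differentiable f y -> 'd f y v = dot v (grad f y).
Proof.
move=> df; rewrite {1}(row_sum_delta v) linear_sum; apply: eq_bigr => i _.
by rewrite linearZ mxE deriveE.
Qed.

Lemma diff_left_projection (R : realType) (n : nat)
    (p : cotangent R n * cotangent R n) :
  differentiable (@left_projection R n) p /\
  forall v, 'd (@left_projection R n) p v = v.1.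
Proof.
have fst_cont := @continuous_fst (cotangent R n) (cotangent R n).
split=> [|v]; first exact: (linear_differentiable p fst_cont).
by have /= -> := diff_lin p fst_cont.
Qed.

Lemma smooth_differentiable (R : realType) (n : nat) (r : 'rV[R]_n -> R) y :
  smooth r -> differentiable r y.
Proof. by move=> /(_ 1)[+ _]; apply. Qed.

Lemma smooth_derive_differentiable (R : realType) (n : nat)
    (r : 'rV[R]_n -> R) v y :
  smooth r -> differentiable ('D_v r) y.
Proof. by move=> /(_ 2)[_ /(_ v)[+ _]]; apply. Qed.

Lemma is_derive_comp_smooth (R : realType) (n : nat) (r : 'rV[R]_n -> R)
    (c : R -> 'rV[R]_n) (t : R) (v : 'rV[R]_n) :
  smooth r -> is_derive t (1 : R) c v ->
  is_derive t (1 : R) (fun s => r (c s)) (dot v (grad r (c t))).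
Proof.
move=> r_smooth dc; have dr := smooth_differentiable (c t) r_smooth.
by rewrite -diff_grad//; exact: is_derive_chain.
Qed.

(** Each partial derivative of [r] is differentiable, and its differential sends the zero velocity
    to 0; no second derivative has to be named. *)
Lemma is_derive_comp_grad0 (R : realType) (n : nat) (r : 'rV[R]_n -> R)
    (c : R -> 'rV[R]_n) (t : R) :
  smooth r -> is_derive t (1 : R) c 0 ->
  is_derive t (1 : R) (fun s => grad r (c s)) 0.
Proof.
move=> r_smooth dc; apply/is_derive_rowP => i.
under eq_fun do rewrite mxE.
rewrite mxE -[X in is_derive _ _ _ X](linear0 ('d ('D_(delta_mx 0 i) r) (c t))).
by apply: is_derive_chain => //; exact: smooth_derive_differentiable.
Qed.

(** * Tangent vectors killed by the left projection *)

(* Differentiating [|x - y|^2 = r^2], [r^2 xi = (xi . (x - y)) (x - y)] and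
   [r (eta - xi) = (xi . (x - y)) grad r]: these relations eliminate the
   coordinates omega and sigma, whose differentiability along the curve need
   not be checked. *)
Lemma tangent_left_projection0 (R : realType) (n : nat) (r : 'rV[R]_n -> R)
    (y omega : 'rV[R]_n) (sigma : R) v :
  (forall y, 0 < r y) -> smooth r ->
  eucl_norm omega = 1 -> sigma != 0 -> 1 + dot omega (grad r y) != 0 ->
  tangent (canonical_relation r) (canonical_point r y omega sigma) v ->
  v.1 = 0 -> v = 0.
Proof.
move=> r_gt0 r_smooth /eucl_norm_eq1 omega1 sigma0 transverse.
case: v => a [u w] [c [c0 cM dc]] /= a0; rewrite {}a0 in dc *.
pose Y s := (c s).1.1; pose E s := (c s).1.2.
pose X s := (c s).2.1; pose Xi s := (c s).2.2.
have dY : is_derive 0 (1 : R) Y 0 := is_derive_fst (is_derive_fst dc).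
have dE : is_derive 0 (1 : R) E 0 := is_derive_snd (is_derive_fst dc).
have dX : is_derive 0 (1 : R) X u := is_derive_fst (is_derive_snd dc).
have dXi : is_derive 0 (1 : R) Xi w := is_derive_snd (is_derive_snd dc).
pose Q s := X s - Y s; pose L s := dot (Xi s) (Q s).
have dQ : is_derive 0 (1 : R) Q u.
  by rewrite -[u]subr0; exact: (is_deriveB dX dY).
have drY : is_derive 0 (1 : R) (fun s => r (Y s)) 0.
  by have := is_derive_comp_smooth r_smooth dY; rewrite dot0l.
have dgY : is_derive 0 (1 : R) (fun s => grad r (Y s)) 0.
  exact: (is_derive_comp_grad0 r_smooth dY).
have dL := is_derive_dot dXi dQ.
have near_rel : \forall s \near (0 : R),
    [/\ dot (Q s) (Q s) = r (Y s) * r (Y s),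
        (r (Y s) * r (Y s)) *: Xi s = L s *: Q s &
        r (Y s) *: (E s - Xi s) = L s *: grad r (Y s)].
  apply: filterS cM => s [y1 [w1 [s1 [/eucl_norm_eq1 w1E s0 cs]]]].
  rewrite /L /Q /Y /E /X /Xi cs/= [y1 + _]addrC addrK.
  rewrite !(dotZl, dotZr) w1E; split; first by ring.
    by rewrite !scalerA; congr (_ *: _); ring.
  by rewrite -scalerBr [w1 + _]addrC addrK !scalerA; congr (_ *: _); ring.
have c0E : [/\ Y 0 = y, Xi 0 = (- 2 * sigma * r y) *: omega,
    E 0 = (- 2 * sigma * r y) *: (omega + grad r y) & Q 0 = r y *: omega].
  by rewrite /Q /Y /E /X /Xi c0/= [y + _]addrC addrK.
case: c0E => Y0 Xi0 E0 Q0.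
set g := grad r y in transverse E0 *; have r0 := r_gt0 y.
have L0 : L 0 = - 2 * sigma * r y * r y.
  by rewrite /L Xi0 Q0 !(dotZl, dotZr) omega1; ring.
(* As [Y] is stationary, so is [r (Y s)]; differentiating the sphere equation leaves
   [2 r(y) omega . u = 0]. *)
have ou : dot omega u = 0.
  have rel : \forall s \near (0 : R), dot (Q s) (Q s) = r (Y s) * r (Y s).
    by apply: filterS near_rel => s [].
  have := near_eq_is_derive_unique rel (is_derive_dot dQ dQ)
    (is_derive_mulr drY drY).
  rewrite Q0 (dotC u) dotZl mul0r mulr0 addr0 -mulr2n => /eqP.
  by rewrite mulrn_eq0 mulf_eq0 (gt_eqF r0) => /eqP.
have L'E : dot w (Q 0) + dot (Xi 0) u = dot w (Q 0).
  by rewrite Xi0 dotZl ou mulr0 addr0.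
rewrite {}L'E in dL; set m := dot w (Q 0) in dL.
have wE : (r y * r y) *: w = m *: Q 0 + L 0 *: u.
  have rel : \forall s \near (0 : R),
      (r (Y s) * r (Y s)) *: Xi s = L s *: Q s.
    by apply: filterS near_rel => s [].
  have := near_eq_is_derive_unique rel
    (is_derive_scale (is_derive_mulr drY drY) dXi) (is_derive_scale dL dQ).
  by rewrite Y0 mul0r mulr0 addr0 scale0r add0r.
have wg : r y *: w = - (m *: g).
  have rel : \forall s \near (0 : R),
      r (Y s) *: (E s - Xi s) = L s *: grad r (Y s).
    by apply: filterS near_rel => s [].
  have := near_eq_is_derive_unique rel
    (is_derive_scale drY (is_deriveB dE dXi)) (is_derive_scale dL dgY).
  rewrite Y0 scale0r add0r sub0r scaler0 addr0 => <-.
  by rewrite scalerN opprK.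
(* Pairing [wg] with [omega], where [r y *: omega = Q 0], gives [m = - m (omega . g)], that is
   [m (1 + omega . g) = 0]. *)
have m0 : m = 0.
  have := congr1 (dot omega) wg.
  rewrite -scaleN1r !dotZr dotC -dotZr -Q0 -/m => /eqP.
  rewrite mulN1r -subr_eq0 opprK -{1}[m]mulr1 -mulrDr mulf_eq0.
  by rewrite (negPf transverse) orbF => /eqP.
have w0 : w = 0.
  apply/eqP; move/eqP: wg; rewrite m0 scale0r oppr0 scaler_eq0.
  by rewrite (gt_eqF r0).
(* Only [L 0 *: u = 0] is left of [wE], and [L 0 = - 2 sigma r(y)^2] is nonzero. *)
have u0 : u = 0.
  apply/eqP; move/eqP: wE; rewrite m0 w0 scaler0 scale0r add0r eq_sym.
  rewrite scaler_eq0 L0 !mulf_eq0 (negPf sigma0) (gt_eqF r0) !orbF.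
  by rewrite oppr_eq0 pnatr_eq0.
by rewrite u0 w0.
Qed.

(** * A kernel vector where transversality fails *)

(* Where [1 + omega . grad r] vanishes, [a = - (omega + grad r)] is tangent to
   the sphere at [omega]; moving omega in the direction [a] while sigma = 1 + s
   leaves [sigma (omega + grad r)] stationary.  The sphere is parametrized
   rationally. *)
Lemma immersion_transverse (R : realType) (n : nat) (r : 'rV[R]_n -> R)
    (y omega : 'rV[R]_n) :
  0 < r y -> immersion_on (canonical_relation r) (@left_projection R n) ->
  dot omega omega = 1 -> 1 + dot omega (grad r y) != 0.
Proof.
move=> r0 imm omega1; apply/eqP => tangency.
set g := grad r y in tangency; pose a := - (omega + g).
have oa : dot omega a = 0.
  by rewrite dotC dotNl dotDl omega1 dotC tangency oppr0.
(* With this [B], [(1 - B s^2)^2 + s^2 |a|^2 = (1 + B s^2)^2], so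
   [((1 - B s^2) omega + s a) / (1 + B s^2)] is a unit vector. This is [o s] below, since
   [2 k - 1 = (1 - B s^2) / (1 + B s^2)]. *)
pose B := dot a a / 4; have B0 : 0 <= B by rewrite divr_ge0// dot_ge0.
have den0 (s : R) : 1 + B * (s * s) != 0.
  by rewrite gt_eqF// ltr_pwDl// mulr_ge0// -expr2 sqr_ge0.
pose k (s : R) := (1 + B * (s * s))^-1.
have kE s : k s * (1 + B * (s * s)) = 1 by rewrite mulVf.
have k0 : k 0 = 1 by rewrite /k !mulr0 addr0 invr1.
have did : is_derive 0 (1 : R) (fun s : R => s) 1 := is_derive_id _ _.
have dscal (x : R) : is_derive 0 (1 : R) (fun _ : R => x) 0.
  exact: is_derive_cst.
have drow (w : 'rV[R]_n) : is_derive 0 (1 : R) (fun _ : R => w) 0.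
  exact: is_derive_cst.
have dk : is_derive 0 (1 : R) k 0.
  have dden : is_derive 0 (1 : R) (fun s : R => 1 + B * (s * s)) 0.
    have := is_deriveD (dscal 1) (is_derive_mulr (dscal B)
      (is_derive_mulr did did)).
    by rewrite !(mulr0, mul0r, addr0).
  have := @is_deriveV _ (fun s => 1 + B * (s * s)) _ _ _ (den0 0) dden.
  by rewrite scaler0.
pose o s := (k s * 2 - 1) *: omega + (s * k s) *: a.
have o1 s : dot (o s) (o s) = 1.
  have aB : dot a a = 4 * B by rewrite /B; field.
  rewrite /o !(dotDl, dotDr, dotZl, dotZr) (dotC a) oa omega1 aB.
  rewrite !mulr0 addr0 add0r mulr1.
  transitivity (1 + 4 * k s * (k s * (1 + B * (s * s)) - 1)); first by ring.
  by rewrite kE subrr mulr0 addr0.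
have o0 : o 0 = omega by rewrite /o k0 mul0r scale0r addr0 mul1r addrK scale1r.
have dO : is_derive 0 (1 : R) o a.
  have := is_deriveD (is_derive_scale
    (is_deriveB (is_derive_mulr dk (dscal 2)) (dscal 1)) (drow omega))
    (is_derive_scale (is_derive_mulr did dk) (drow a)).
  by rewrite k0 !(mul0r, mulr0, add0r, addr0, subr0, mul1r, scaler0,
    scale0r, scale1r).
pose l (s : R) := - 2 * (1 + s) * r y.
have l0 : l 0 = - 2 * r y by rewrite /l addr0 mulr1.
have dl : is_derive 0 (1 : R) l (- 2 * r y).
  have := is_derive_mulr (is_derive_mulr (dscal (- 2))
    (is_deriveD (dscal 1) did)) (dscal (r y)).
  by rewrite !(mul0r, mulr0, add0r, addr0, mulr1).
have dog : is_derive 0 (1 : R) (fun s => o s + g) a.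
  by have := is_deriveD dO (drow g); rewrite addr0.
have dx : is_derive 0 (1 : R) (fun s => y + r y *: o s) (r y *: a).
  have := is_deriveD (drow y) (is_derive_scale (dscal (r y)) dO).
  by rewrite scale0r !add0r.
have dc := is_derive_pair (is_derive_pair (drow y) (is_derive_scale dl dog))
  (is_derive_pair dx (is_derive_scale dl dO)).
have [|_ inj] := imm (canonical_point r y omega 1).
  exists y, omega, 1; split=> //; first exact/eucl_norm_eq1.
have ogaa : (- 2 * r y) *: (o 0 + g) + l 0 *: a = 0.
  by rewrite l0 o0 -scalerDr subrr scaler0.
rewrite {}ogaa in dc.
set v := (X in is_derive _ _ _ X) in dc.
have tv : tangent (canonical_relation r) (canonical_point r y omega 1) v.
  exists (fun s => canonical_point r y (o s) (1 + s)); split=> //.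
    by rewrite addr0 o0.
  near=> s; exists y, (o s), (1 + s); split=> //; first exact/eucl_norm_eq1.
  have : `|s| < 1 by near: s; exact: (@nbhs0_lt R R _ ltr01).
  by rewrite ltr_norml => /andP[s1 _]; rewrite gt_eqF// -ltrBlDl sub0r.
have dv0 : 'd (@left_projection R n) (canonical_point r y omega 1) v = 0.
  by rewrite (diff_left_projection _).2.
(* Injectivity forces the x-velocity [r y *: a] to vanish, so [a = 0]; the xi-velocity then reduces
   to [- 2 r(y) omega], which cannot vanish. The case [a = 0], where [o] is constant, is thus
   covered. *)
have [/eqP + /eqP] : r y *: a = 0 /\ (- 2 * r y) *: o 0 + l 0 *: a = 0.
  by have := inj v tv dv0 => -[].
rewrite l0 o0 -scalerDr !scaler_eq0 (gt_eqF r0) orbF/=.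
move=> /eqP ->; rewrite addr0 oppr_eq0 pnatr_eq0/= => /eqP omega0.
by move: omega1; rewrite omega0 dot0l => /esym/eqP; rewrite oner_eq0.
Unshelve. all: by end_near. Qed.

(** * Sign of 1 + omega . grad r *)

Lemma derive_gt_m1 (R : realType) (h : R -> R) :
  (forall t, 0 < h t) -> (forall t, derivable h t 1) ->
  continuous ('D_1 h) -> (forall t, 1 + 'D_1 h t != 0) ->
  forall t, 0 < 1 + 'D_1 h t.
Proof.
(* h would decrease with slope at most -1 after t and become negative. *)
move=> h0 dh h'cont h'1 t; rewrite lt_neqAle eq_sym h'1/= leNgt.
apply/negP => h't.
have tb : t < t + h t by rewrite ltrDl.
(* The interval has length [h t], so that [h t * (1 + 'D_1 h x)] equals [h (t + h t)], which is
   positive. *)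
have [x xtb hx] : exists2 x, x \in `]t, t + h t[ &
    h (t + h t) - h t = 'D_1 h x * (t + h t - t).
  apply: MVT => //.
  by apply: derivable_within_continuous => x _; exact: (dh x).
have h'x : 0 <= 1 + 'D_1 h x.
  rewrite -(pmulr_rge0 _ (h0 t)) mulrDr mulr1 [h t * _]mulrC.
  move: hx; rewrite [t + h t - t]addrC addKr => <-.
  by rewrite addrC subrK ltW.
have tx : t <= x by move: xtb; rewrite in_itv/= => /andP[/ltW].
(* The sign change between [t] and [x] produces a zero of [1 + 'D_1 h], excluded by [h'1]. *)
have [||z _ /eqP] := @IVT R (fun s => 1 + 'D_1 h s) t x 0 tx.
- apply: continuous_subspaceT => s.
  by apply: cvgD; [exact: cvg_cst | exact: h'cont].
- by rewrite ge_min le_max (ltW h't) h'x orbT.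
- by rewrite (negPf (h'1 z)).
Qed.

(** Restricting [r] to the line through [y] with direction [v] reduces the claim to one variable. *)
Lemma grad_dot_gt_m1 (R : realType) (n : nat) (r : 'rV[R]_n -> R)
    (y v : 'rV[R]_n) :
  (forall y, 0 < r y) -> smooth r ->
  (forall y, 1 + dot v (grad r y) != 0) -> 0 < 1 + dot v (grad r y).
Proof.
move=> r_gt0 r_smooth transverse.
pose l (t : R) := y + t *: v; pose h t := r (l t).
have dl t : is_derive t (1 : R) l v.
  have := is_deriveD (is_derive_cst y t 1)
    (is_derive_scale (is_derive_id t 1) (is_derive_cst v t 1)).
  by rewrite add0r scale1r scaler0 addr0.
have dh t : is_derive t (1 : R) h (dot v (grad r (l t))).
  exact: is_derive_comp_smooth.
have h'E t : 'D_1 h t = dot v (grad r (l t)) by case: (dh t).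
have l0 : l 0 = y by rewrite /l scale0r addr0.
have -> : dot v (grad r y) = 'D_1 h 0 by rewrite h'E l0.
apply: derive_gt_m1 => [t|t||t]; rewrite ?h'E//; first exact: r_gt0.
have -> : 'D_1 h = 'D_v r \o l.
  apply/funext => t /=; rewrite h'E deriveE ?diff_grad//;
  exact: smooth_differentiable.
move=> t; apply: continuous_comp; apply: differentiable_continuous.
  by apply/derivable1_diffP; case: (dl t).
exact: smooth_derive_differentiable.
Qed.

(** Expanding [|u + v|^2 >= 0] gives [1 + 2 u . v + |v|^2 >= 0], and [|v|^2 < 1]. *)
Lemma dot_gt_m1 (R : realType) (n : nat) (u v : 'rV[R]_n) :
  dot u u = 1 -> eucl_norm v < 1 -> 0 < 1 + dot u v.
Proof.
move=> u1; rewrite eucl_normE => v1.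
have vv1 : dot v v < 1.
  rewrite -[X in X < _]sqr_sqrtr ?dot_ge0// -[X in _ < X](expr1n _ 2).
  by rewrite ltr_sqr ?nnegrE ?sqrtr_ge0.
have := dot_ge0 (u + v).
rewrite !(dotDl, dotDr) u1 (dotC v u); lra.
Qed.

Unset Implicit Arguments.

Theorem theorem3p2 (R : realType) (n : nat) (r : 'rV[R]_n -> R)
    (r_gt0 : forall y, 0 < r y) (r_smooth : smooth r) :
  immersion_on (canonical_relation r) (@left_projection R n) <->
  (forall y, eucl_norm (grad r y) < 1).
Proof.
split=> [imm y|grad1 p [y [omega [sigma [omega1 sigma0 ->]]]]].
  rewrite ltNge; apply/negP => g1.
  set g := grad r y in g1; set N := eucl_norm g in g1.
  have N0 : 0 < N by exact: lt_le_trans g1.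
  have gg : dot g g = N * N by rewrite -expr2 sqr_sqrtr ?dot_ge0.
  (* The unit vector opposite to the gradient, for which [1 + omega . g = 1 - N]; [N >= 1] makes the
     division legitimate. *)
  pose omega := - N^-1 *: g.
  have omega1 : dot omega omega = 1.
    by rewrite dotZl dotZr gg; field; rewrite gt_eqF.
  have := @grad_dot_gt_m1 R n r y omega r_gt0 r_smooth
    (fun z => immersion_transverse (r_gt0 z) imm omega1).
  rewrite -/g dotZl gg mulrA mulNr mulVf ?gt_eqF// mulN1r subr_gt0.
  by rewrite ltNge g1.
have [dp dpE] := diff_left_projection (canonical_point r y omega sigma).
split=> // v tv; rewrite dpE.
apply: (tangent_left_projection0 r_gt0 r_smooth omega1 sigma0 _ tv).
by rewrite gt_eqF//; apply: dot_gt_m1 => //; exact/eucl_norm_eq1.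
Qed.
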